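(* Let $\omega=\{\omega_n\}_{n\ge 0}$ be a sequence of positive real numbers with $\omega_0=1$ and $\lim_{n\to\infty}\omega_n/\omega_{n+1}=1$, and let $\mathcal{J}_\omega$ be the infinite Jacobi matrix with entries $(\mathcal{J}_\omega)_{j,j+1}=(\mathcal{J}_\omega)_{j+1,j}=\sqrt{\omega_j/\omega_{j+1}}$ for $j\ge1$ and all other entries zero. (i) There exists a function $f\in H^2_\omega$ with $f(0)\neq0$ having an optimal polynomial approximant to $1/f$ that vanishes at some point of the open unit disk if and only if $\|\mathcal{J}_\omega\|>2$. Equivalently, there exist weighted reproducing kernels $k_n(z,0)$ with zeros inside the open unit disk if and only if $\|\mathcal{J}_\omega\|>2$. (ii) If $\|\mathcal{J}_\omega\|=2$, then all the zeros of optimal polynomial approximants (to $1/f$, $f\in H^2_\omega$, $f(0)\ne0$), or equivalently of weighted reproducing kernels $k_n(z,0)$, lie outside the open unit disk. Moreover, if the shift operator does not decrease the norm, i.e., if $\|zf\|_\omega\ge\|f\|_\omega$ for all $f\in H^2_\omega$, then these zeros lie outside the closed unit disk. In particular, this occurs in all spaces $D_\alpha$ with $\alpha\ge0$ or, more generally, in any space $H^2_\omega$ with $\inf_n(\omega_{n+1}/\omega_n)\ge1$.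
   Context: $H^2_\omega$ is the Hilbert space of functions $f(z)=\sum_{n\ge0}a_nz^n$ analytic in the open unit disk $\mathbb{D}$ with $\|f\|_\omega^2=\sum_{n\ge0}|a_n|^2\omega_n<\infty$ and inner product $\langle \sum a_nz^n,\sum b_nz^n\rangle_\omega=\sum_{n\ge0}a_n\overline{b_n}\,\omega_n$. $D_\alpha$ denotes $H^2_\omega$ for $\omega_n=(n+1)^\alpha$. $\mathcal{P}_n$ is the space of polynomials of degree at most $n$. For $f\in H^2_\omega$, the optimal (polynomial) approximant of order $n$ to $1/f$ is the unique $p_n\in\mathcal{P}_n$ minimizing $\|pf-1\|_\omega$ over $p\in\mathcal{P}_n$. For $f\in H^2_\omega$ with $f(0)\ne0$, the weighted reproducing kernel $k_n(z,w)$ is the reproducing kernel of $\mathcal{P}_n$ with the inner product $\langle g,h\rangle_f:=\langle gf,hf\rangle_\omega$; one has $p_n(z)=\overline{f(0)}\,k_n(z,0)$. Rows and columns of $\mathcal{J}_\omega$ are indexed by $1,2,3,\dots$, and $\|\mathcal{J}_\omega\|$ is its operator norm on $\ell^2$. *)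

(* Defs.v *)
From HB Require Import structures.
From mathcomp Require Import all_boot all_order all_algebra.
From mathcomp Require Import all_classical all_reals all_analysis.
From mathcomp Require Export complex.

Set Implicit Arguments.
Unset Strict Implicit.
Unset Printing Implicit Defensive.

Import Order.TTheory GRing.Theory Num.Theory numFieldNormedType.Exports.

Local Open Scope classical_set_scope.
Local Open Scope ring_scope.
Local Open Scope complex_scope.

Section Defs.
Variable R : realType.
(* The regular module carries the topology induced by the modulus. *)
Local Notation C := (R[i]^o).
Implicit Types (w : nat -> R) (f g : C -> C) (a b x : nat -> C).

Definition admissible_weight w : Prop :=
  [/\ forall n, 0 < w n, w 0 = 1 & (fun n => w n / w n.+1) @ \oo --> (1 : R)].

Definition weighted_norm w a : \bar R :=
  sqrte (\sum_(0 <= n <oo) (ComplexField.Normc.normc (a n) ^+ 2 * w n)%:E)%E.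

(* Functions on the disk are represented by functions on the whole plane;
   everything below depends only on their values on the open unit disk. *)
Definition expands_as f a : Prop :=
  forall z : C, `|z| < 1 -> series (fun n => a n * z ^+ n) @ \oo --> f z.

Definition coefs f : nat -> C := get [set a | expands_as f a].

Definition H2norm w f : \bar R := weighted_norm w (coefs f).

Definition H2 w : set (C -> C) :=
  [set f | (exists a, expands_as f a) /\ (H2norm w f < +oo)%E].

Definition H2dot w f g : C :=
  limn (series (fun n => coefs f n * (coefs g n)^*%C * (w n)%:C : C)).

Definition polymul (p : {poly R[i]}) f : C -> C := fun z => p.[z] * f z.

(* p minimizes the norm of p f - 1 over polynomials of degree <= n *)
Definition optimal_approximant w f (n : nat) (p : {poly R[i]}) : Prop :=
  (size p <= n.+1)%N /\
  forall q : {poly R[i]}, (size q <= n.+1)%N ->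
    (H2norm w (fun z => (polymul p f z - 1)%R)
       <= H2norm w (fun z => (polymul q f z - 1)%R))%E.

(* K v is the polynomial k_n(., v). *)
Definition weighted_kernel w f (n : nat) (K : R[i] -> {poly R[i]}) : Prop :=
  forall v : R[i], (size (K v) <= n.+1)%N /\
    forall q : {poly R[i]}, (size q <= n.+1)%N ->
      q.[v] = H2dot w (polymul q f) (polymul (K v) f).

Definition approximant_zero w (z : R[i]) : Prop :=
  exists f n p, [/\ H2 w f, f 0 != 0, optimal_approximant w f n p & root p z].

Definition kernel_zero w (z : R[i]) : Prop :=
  exists f n K, [/\ H2 w f, f 0 != 0, weighted_kernel w f n K & root (K 0) z].

Definition shift_norm_nondecreasing w : Prop :=
  forall f, H2 w f -> (H2norm w f <= H2norm w (fun z => (z * f z)%R))%E.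

(* Only the entries with j, k >= 1 belong to the matrix. *)
Definition jacobi w (j k : nat) : R :=
  if k == j.+1 then Num.sqrt (w j / w k)
  else if j == k.+1 then Num.sqrt (w k / w j)
  else 0.

Definition l2norm x : \bar R := weighted_norm (fun=> 1) x.

(* Matrices are indexed from 1 and vectors from 0, hence the successors. *)
Definition matrix_apply (A : nat -> nat -> R) x : nat -> C :=
  fun j => limn (series (fun k => (A j.+1 k.+1)%:C * x k : C)).

Definition l2_opnorm (A : nat -> nat -> R) : \bar R :=
  ereal_sup [set l2norm (matrix_apply A x) | x in [set x | (l2norm x <= 1)%E]].

Definition dirichlet_weight (alpha : R) : nat -> R :=
  fun n => n.+1%:R `^ alpha.

End Defs.

(* Main.v *)
Require Import Defs.
From mathcomp Require Import all_boot all_order all_algebra.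
From mathcomp Require Import all_classical all_reals all_analysis.
From mathcomp Require Import ring lra.
Import Order.TTheory GRing.Theory Num.Theory numFieldNormedType.Exports.
Import ComplexField.Normc.
Local Open Scope classical_set_scope.
Local Open Scope ring_scope.
Local Open Scope complex_scope.

(* If [z] is a zero of an optimal approximant [p = (X - z) q] of [f], then for [g = q f]
   the minimality of [p] makes [(X - z) g] orthogonal to [X g], that is
   [||X g||^2 = z <g, X g>].  With [x_n = |g_n| sqrt(w_(n+1))], the quotient of
   [|<g, X g>|] by [||X g||^2] is at most half a Rayleigh quotient of the Jacobi matrix,
   so [1 / |z|] is at most half its norm; conversely a positive test vector with
   Rayleigh quotient above 2 is turned into a polynomial [g] whose degree one
   approximant has the zero [||X g||^2 / <g, X g> < 1].  If the shift does not decrease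
   the norm, Pythagoras gives [|z|^2 ||g||^2 = ||X g||^2 + ||(X - z) g||^2 > ||g||^2].
   Kernels reduce to approximants through [p_n = conj(f(0)) k_n(., 0)]. *)

Set Implicit Arguments.
Unset Strict Implicit.
Unset Printing Implicit Defensive.

Local Notation Re := (@complex.Re _).
Local Notation Im := (@complex.Im _).

(** * Power series on the unit disk *)

Section ComplexSequences.
Variable R : realType.
Local Notation C := (R[i]^o).
Implicit Types (a b d : nat -> C) (f g : C -> C) (z : C).

(** Real parts of inner products carry the whole lower bound on zeros: minimality along real
    multiples gives [Re <(X - z) g, X g> = 0], which is enough both for
    [||X g||^2 <= |z| |<g, X g>|] and for Pythagoras. The analysis therefore runs on the real
    pairing [rdot]; the complex pairing is computed only to verify a reproducing identity, on finite
    sequences. The choice of [x_n] is forced: [||X g||^2] is the sum of the [x_n^2], and [|g_n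
    g_(n+1)| w_(n+1) = sqrt(w_(n+1) / w_(n+2)) x_n x_(n+1)] exhibits the Jacobi entry. The threshold
    is 2 because each entry occurs twice in the symmetric matrix. The operator norm is a supremum
    over complex square-summable vectors, whereas both directions want a quadratic form on finite
    real vectors. Symmetry of the matrix and nonnegativity of its entries bridge the gap. The limit
    of [w n / w n.+1] serves twice: it makes the shift bounded, so that [p f] stays in the space,
    and it keeps the norm of the matrix from falling below 2 when the weights are nondecreasing. *)

Lemma normE (z : R[i]) : `|z| = (normc z)%:C.
Proof. by case: z. Qed.

Lemma normc_ge0 (z : R[i]) : 0 <= normc z.
Proof. by case: z => x y; exact: sqrtr_ge0. Qed.

Lemma normc_real (x : R) : normc x%:C = `|x|.
Proof. by rewrite /= expr0n addr0 sqrtr_sqr. Qed.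

Lemma norm_lt1 (z : R[i]) : (`|z| < 1) = (normc z < 1).
Proof. by rewrite normE -ltcR. Qed.

Lemma normc_sqr (z : R[i]) : normc z ^+ 2 = Re z ^+ 2 + Im z ^+ 2.
Proof. by case: z => x y /=; rewrite sqr_sqrtr// addr_ge0 ?sqr_ge0. Qed.

Lemma normc_eq0 (z : R[i]) : (normc z == 0) = (z == 0).
Proof. by apply/eqP/eqP => [/eq0_normc//|->]; rewrite normc0. Qed.

Lemma normcX (z : R[i]) n : normc (z ^+ n) = normc z ^+ n.
Proof. by elim: n => [|n IHn]; rewrite ?normc1// !exprS normcM IHn. Qed.

Lemma normc_sum (I : Type) (r : seq I) (F : I -> R[i]) :
  normc (\sum_(i <- r) F i) <= \sum_(i <- r) normc (F i).
Proof.
elim/big_ind2: _ => [|x1 x2 y1 y2 h1 h2|//]; first by rewrite normc0.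
by apply: le_trans (le_normcD _ _) _; rewrite lerD.
Qed.

(** The norm of [R[i]] is itself complex-valued, and so is the tolerance in its topology; a positive
    complex number is real, so real tolerances suffice. *)
Lemma cvgn_complexP a (l : C) :
  (a @ \oo --> l) <->
  forall e : R, 0 < e -> \forall n \near \oo, normc (l - a n) < e.
Proof.
split.
  move=> /cvgrPdist_lt al e e0.
  have e0' : 0 < e%:C :> R[i] by rewrite -(ltcR 0 e) in e0.
  by near=> n; rewrite -ltcR -normE; near: n; exact: al.
move=> al; apply/cvgrPdist_lt => e e0.
have eE : e = (Re e)%:C.
  by apply/esym/RRe_real; rewrite realE ltW.
have e0' : 0 < Re e by rewrite -ltcR -eE.
by near=> n; rewrite eE normE ltcR; near: n; exact: al.
Unshelve. all: by end_near. Qed.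

(** The subtracted term makes the bound inductive: [x ^+ n <= 2 * x ^+ n - 2 * x ^+ n.+1] exactly
    because [x <= 2^-1]. *)
Lemma geometric_tail_le (x : R) m n : 0 <= x -> x <= 2^-1 -> (m <= n)%N ->
  \sum_(m <= i < n) x ^+ i <= 2 * x ^+ m - 2 * x ^+ n.
Proof.
move=> x0 x1; elim: n => [|n IHn]; rewrite ?leqn0.
  by move=> /eqP->; rewrite big_geq// subrr.
rewrite leq_eqVlt => /orP[/eqP->|]; first by rewrite big_geq// subrr.
rewrite ltnS => mn; rewrite big_nat_recr//=.
have := IHn mn; have : 0 <= x ^+ n by rewrite exprn_ge0.
rewrite exprS; nra.
Qed.

(** Convergence at [2^-1] bounds the coefficients by [M * 2 ^+ n]. If all coefficients before [d k]
    vanish, then at a small real [t] the term [d k * t ^+ k] is balanced by a tail of order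
    [t ^+ k.+1]; dividing by [t ^+ k] and letting [t] tend to 0 gives [d k = 0]. *)
Lemma power_series_eq0 d :
  (forall z, `|z| < 1 -> series (fun n => d n * z ^+ n) @ \oo --> (0 : C)) ->
  d = (fun=> 0).
Proof.
move=> dz.
have [M M0 dM] : exists2 M : R, 0 <= M & forall n, normc (d n) <= M * 2 ^+ n.
  have half : `|(2^-1)%:C : R[i]| < 1.
    by rewrite norm_lt1 normc_real ger0_norm; lra.
  have /(cvgP _)/cvg_series_cvg_0/(cvgP _)/cvg_seq_bounded := dz _ half.
  move=> /pinfty_ex_gt0[M M0 dM]; have ME : M = (Re M)%:C.
    by apply/esym/RRe_real; rewrite realE ltW.
  exists (Re M); first by rewrite -lecR -ME ltW.
  move=> n; have := dM n Logic.I.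
  rewrite /= normE ME lecR normcM normcX normc_real ger0_norm; last by lra.
  by rewrite exprVn ler_pdivrMr ?exprn_gt0.
apply/funext; apply: (@well_founded_ind _ _ Wf_nat.lt_wf) => k IHk.
have dk (t : R) : 0 < t -> t <= 4^-1 -> normc (d k) <= 4 * M * 2 ^+ k * t.
  move=> t0 t1; apply/ler_addgt0Pr => e e0.
  have tz : `|t%:C : R[i]| < 1 by rewrite norm_lt1 normc_real ger0_norm; lra.
  have etk : 0 < e * t ^+ k by rewrite mulr_gt0 ?exprn_gt0.
  have /cvgn_complexP/(_ _ etk)[N _ /(_ (maxn N k.+1))] := dz _ tz.
  rewrite /= leq_maxl sub0r normcN => /(_ isT).
  set n := maxn N k.+1; have kn : (k < n)%N by rewrite leq_maxr.
  rewrite /series /= (@big_cat_nat _ _ _ k)//=; last exact: ltnW.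
  rewrite big1_seq ?add0r; last first.
    by move=> i /andP[_]; rewrite mem_index_iota => /andP[_ /ssrnat.ltP/IHk->]; rewrite mul0r.
  rewrite big_ltn//; set s := \sum_(k.+1 <= i < n) _ => hs.
  have sM : normc s <= M * (2 * (2 * t) ^+ k.+1).
    apply: (le_trans (normc_sum _ _)).
    apply: (@le_trans _ _ (M * \sum_(k.+1 <= i < n) (2 * t) ^+ i)).
      rewrite mulr_sumr ler_sum// => i _.
      rewrite normcM normcX normc_real gtr0_norm// exprMn mulrA.
      by rewrite ler_wpM2r// exprn_ge0// ltW.
    rewrite ler_wpM2l//; apply: le_trans (geometric_tail_le _ _ kn) _; [lra|lra|].
    by rewrite gerBl mulr_ge0// exprn_ge0//; lra.
  have : normc (d k) * t ^+ k <= e * t ^+ k + 4 * M * 2 ^+ k * t * t ^+ k.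
    have -> : normc (d k) * t ^+ k = normc (d k * t%:C ^+ k + s - s).
      by rewrite addrK normcM normcX normc_real gtr0_norm.
    apply: (le_trans (le_normcD _ _)); rewrite normcN lerD// ?(ltW hs)//.
    by apply: (le_trans sM); rewrite exprMn !exprS; lra.
  by rewrite -mulrDl ler_pM2r ?exprn_gt0// addrC.
apply/eqP; rewrite -normc_eq0 eq_le normc_ge0 andbT; apply/ler_addgt0Pr => e e0.
set L := 4 * M * 2 ^+ k in dk.
have L0 : 0 <= L by rewrite !mulr_ge0 ?exprn_ge0.
(* This [t] is at most [4^-1] and satisfies [L * t <= e], with a denominator that is positive even
   when [L = 0]. *)
have t0 : 0 < e / (L + 4 * e + 1) by rewrite divr_gt0//; lra.
have t1 : e / (L + 4 * e + 1) <= 4^-1 by rewrite ler_pdivrMr; lra.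
apply: (le_trans (dk _ t0 t1)); rewrite add0r mulrA ler_pdivrMr; last by lra.
by nra.
Qed.

Lemma eq_cvgn a b (l : C) : a =1 b -> b @ \oo --> l -> a @ \oo --> l.
Proof. by move=> /funext->. Qed.

Lemma expands_asB f g a b : expands_as f a -> expands_as g b ->
  expands_as (fun z => f z - g z) (a - b).
Proof.
move=> fa gb z z1; apply: eq_cvgn (cvgB (fa z z1) (gb z z1)) => n /=.
by rewrite -[RHS]sumrB; apply: eq_bigr => i _; rewrite -mulrBl.
Qed.

Lemma expands_as_inj f a b : expands_as f a -> expands_as f b -> a = b.
Proof.
move=> fa fb; suff : a - b = (fun=> 0).
  by move=> ab; apply/funext => n; apply/subr0_eq; have := congr1 (@^~ n) ab.
by apply: power_series_eq0 => z z1; rewrite -(subrr (f z)); exact: expands_asB.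
Qed.

(** [coefs] chooses some expansion; uniqueness turns the choice into the expansion at hand, which is
    how [H2norm] and [H2dot] become computable. *)
Lemma coefsE f a : expands_as f a -> coefs f = a.
Proof.
by move=> fa; apply: (@expands_as_inj f) => //; exact: (@getPex _ [set a | expands_as f a] (ex_intro _ a fa)).
Qed.

Definition shift a : nat -> C := fun n => if n is m.+1 then a m else 0.

Definition conv (p : {poly R[i]}) a : nat -> C :=
  fun n => \sum_(i < n.+1) p`_i * a (n - i)%N.

Lemma expands_asD f g a b : expands_as f a -> expands_as g b ->
  expands_as (fun z => f z + g z) (a + b).
Proof.
move=> fa gb z z1; apply: eq_cvgn (cvgD (fa z z1) (gb z z1)) => n /=.
by rewrite -[RHS]big_split; apply: eq_bigr => i _; rewrite [LHS]mulrDl.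
Qed.

Lemma expands_asZ c f a : expands_as f a -> expands_as (fun z => c * f z) (c *: a).
Proof.
move=> fa z z1; apply: eq_cvgn (cvgZl_tmp (k := c) (fa z z1)) => n /=.
by rewrite [RHS]mulr_sumr; apply: eq_bigr => i _; rewrite -[LHS]mulrA.
Qed.

Lemma expands_as_shift f a : expands_as f a -> expands_as (fun z => z * f z) (shift a).
Proof.
move=> fa z z1; rewrite -(cvg_shiftS _); apply: eq_cvgn (cvgZl_tmp (k := z) (fa z z1)) => n /=.
rewrite [RHS]mulr_sumr /series /= big_nat_recl//= mul0r add0r.
by apply: eq_bigr => i _; rewrite exprS mulrCA.
Qed.

Lemma expands_as_finite a n : (forall i, (n <= i)%N -> a i = 0) ->
  expands_as (fun z => \sum_(i < n) a i * z ^+ i) a.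
Proof.
move=> an z z1; apply: cvg_near_cst; exists n => // m /= nm.
rewrite /series /= (@big_cat_nat _ _ _ n)//= big_mkord [X in _ + X]big1_seq ?addr0//.
by move=> i /andP[_]; rewrite mem_index_iota => /andP[/an-> _]; rewrite mul0r.
Qed.

Lemma expands_as0 f a : expands_as f a -> f 0 = a 0.
Proof.
move=> fa; have z0 : `|0 : R[i]| < 1 by rewrite normr0.
have h : series (fun n => a n * 0 ^+ n) @ \oo --> (a 0 : C).
  rewrite -(cvg_shiftS _); apply: cvg_near_cst; apply: nearW => n.
  rewrite /series /= big_nat_recl//= expr0 mulr1 big1 ?addr0// => i _.
  by rewrite exprS mul0r mulr0.
exact: (cvg_unique (@norm_hausdorff _ C) (fa _ z0) h).
Qed.

Lemma conv0 a : conv 0 a = 0.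
Proof. by apply/funext => n; rewrite /conv big1// => i _; rewrite coef0 mul0r. Qed.

Lemma convD p q a : conv (p + q) a = conv p a + conv q a.
Proof.
apply/funext => n; rewrite /conv -[RHS]big_split /=.
by apply: eq_bigr => i _; rewrite coefD mulrDl.
Qed.

Lemma convB p q a : conv (p - q) a = conv p a - conv q a.
Proof.
apply/funext => n; rewrite /conv -[RHS]sumrB /=.
by apply: eq_bigr => i _; rewrite coefB mulrBl.
Qed.

Lemma convZ c p a : conv (c *: p) a = c *: conv p a.
Proof.
apply/funext => n; rewrite [RHS]mulr_sumr /conv.
by apply: eq_bigr => i _; rewrite coefZ mulrA.
Qed.

Lemma convC c a : conv c%:P a = c *: a.
Proof.
apply/funext => n; rewrite /conv big_ord_recl/= coefC/= subn0 big1 ?addr0// => i _.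
by rewrite coefC /= mul0r.
Qed.

Lemma convMX p a : conv (p * 'X) a = shift (conv p a).
Proof.
apply/funext => -[|n]; rewrite /conv /=; first by rewrite big_ord1 coefMX mul0r.
rewrite big_ord_recl/= coefMX mul0r add0r.
by apply: eq_bigr => i _; rewrite coefMX.
Qed.

(** Once the earlier coefficients of [p] vanish, the [n]-th coefficient of the product is the [n]-th
    coefficient of [p] times [a 0]. *)
Lemma conv_neq0 p a : p != 0 -> a 0 != 0 -> conv p a != 0.
Proof.
move=> p0 a0; apply: contra p0 => /eqP pa; apply/eqP/polyP => n; rewrite coef0.
apply: (@well_founded_ind _ _ Wf_nat.lt_wf (fun n => p`_n = 0)) => {}n IHn.
have := congr1 (@^~ n) pa; rewrite /conv /= big_ord_recr/= subnn big1 ?add0r.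
  by move/eqP; rewrite mulf_eq0 (negPf a0) orbF => /eqP.
by move=> i _; rewrite IHn ?mul0r//; apply/ssrnat.ltP.
Qed.

Lemma expands_as_polymul p f a : expands_as f a ->
  expands_as (polymul p f) (conv p a).
Proof.
move=> fa; elim/poly_ind: p => [|p c IHp].
  rewrite conv0 (_ : polymul 0 f = fun z => 0 * f z).
    by rewrite -(scale0r a); exact: expands_asZ.
  by apply/funext => z; rewrite /polymul horner0.
rewrite convD convMX convC.
rewrite (_ : polymul _ _ = fun z => z * polymul p f z + c * f z).
  by apply: expands_asD; [exact: expands_as_shift|exact: expands_asZ].
apply/funext => z; rewrite /polymul hornerMXaddC.
have distr (u v x y : R[i]) : (u * v + x) * y = v * (u * y) + x * y by ring.
exact: distr.
Qed.

End ComplexSequences.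

(** * Weighted square-summable sequences *)

Section WeightedSquareSummable.
Variable R : realType.
Local Notation C := (R[i]^o).
Implicit Types (a b u v : nat -> C) (z : C) (t : R).
Variable w : nat -> R.
Hypothesis w_gt0 : forall n, 0 < w n.

(** This is the real part of [x] times the conjugate of [y], the Euclidean inner product of the
    plane. *)
Definition cdot (x y : R[i]) : R := Re x * Re y + Im x * Im y.

Definition square_summable a : Prop :=
  cvgn (series (fun n => normc (a n) ^+ 2 * w n)).

Definition sqnorm a : R := limn (series (fun n => normc (a n) ^+ 2 * w n)).

Definition rdot a b : R := limn (series (fun n => cdot (a n) (b n) * w n)).

Lemma Re_sum (I : Type) (r : seq I) (F : I -> R[i]) :
  Re (\sum_(i <- r) F i) = \sum_(i <- r) Re (F i).
Proof. by elim/big_rec2: _ => // i x y _ <-; case: (F i) y => ? ? []. Qed.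

Lemma Im_sum (I : Type) (r : seq I) (F : I -> R[i]) :
  Im (\sum_(i <- r) F i) = \sum_(i <- r) Im (F i).
Proof. by elim/big_rec2: _ => // i x y _ <-; case: (F i) y => ? ? []. Qed.

Lemma normc_leRI (z : R[i]) : normc z <= `|Re z| + `|Im z|.
Proof.
case: z => x y /=; rewrite -[leRHS]ger0_norm ?addr_ge0// -sqrtr_sqr ler_wsqrtr//.
by rewrite sqrrD !real_normK ?num_real// addrAC lerDl mulrn_wge0// mulr_ge0.
Qed.

Lemma norm_cdot_le (x y : R[i]) : `|cdot x y| <= normc x ^+ 2 + normc y ^+ 2.
Proof.
rewrite !normc_sqr /cdot ler_norml; apply/andP.
move: (Re x) (Im x) (Re y) (Im y) => p q r s.
have h1 := sqr_ge0 (p - r); have h2 := sqr_ge0 (q - s).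
have h3 := sqr_ge0 (p + r); have h4 := sqr_ge0 (q + s).
have h5 := sqr_ge0 p; have h6 := sqr_ge0 q; have h7 := sqr_ge0 r; have h8 := sqr_ge0 s.
by split; lra.
Qed.

Lemma weighted_sq_ge0 a n : 0 <= normc (a n) ^+ 2 * w n.
Proof. by rewrite mulr_ge0 ?sqr_ge0// ltW. Qed.

Lemma square_summable_le (a : nat -> C) (h : nat -> R) : (forall n, normc (a n) ^+ 2 * w n <= h n) ->
  cvgn (series h) -> square_summable a.
Proof.
move=> ah; apply: series_le_cvg => // n; first exact: weighted_sq_ge0.
by apply: le_trans (ah n); exact: weighted_sq_ge0.
Qed.

Lemma is_cvg_rdot a b : square_summable a -> square_summable b ->
  cvgn (series (fun n => cdot (a n) (b n) * w n)).
Proof.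
move=> sa sb; apply: normed_cvg.
apply: series_le_cvg (is_cvg_seriesD sa sb) => n; first exact: normr_ge0.
  by rewrite addr_ge0 ?weighted_sq_ge0.
by rewrite [leLHS]normrM (gtr0_norm (w_gt0 n)) -[leRHS]mulrDl ler_wpM2r ?norm_cdot_le// ltW.
Qed.

Lemma square_summableZ z a : square_summable a -> square_summable (z *: a).
Proof.
move=> sa; apply: square_summable_le (is_cvg_seriesZ (k := normc z ^+ 2) sa) => n.
by rewrite [X in normc X]/(z * a n) normcM exprMn -mulrA.
Qed.

Lemma square_summableD a b : square_summable a -> square_summable b ->
  square_summable (a + b).
Proof.
move=> sa sb; apply: square_summable_le (is_cvg_seriesZ (k := 2) (is_cvg_seriesD sa sb)) => n.
rewrite -[leRHS]/(2 * (normc (a n) ^+ 2 * w n + normc (b n) ^+ 2 * w n)).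
rewrite -mulrDl mulrA ler_wpM2r ?(ltW (w_gt0 n))//.
have : normc ((a + b) n) ^+ 2 <= (normc (a n) + normc (b n)) ^+ 2.
  by rewrite ler_sqr ?nnegrE ?addr_ge0 ?normc_ge0// le_normcD.
have := sqr_ge0 (normc (a n) - normc (b n)); lra.
Qed.

Lemma square_summable_finite a n : (forall i, (n <= i)%N -> a i = 0) ->
  square_summable a.
Proof.
move=> an; apply/cvg_ex; exists (\sum_(i < n) normc (a i) ^+ 2 * w i).
apply: cvg_near_cst; exists n => // m /= nm.
rewrite /series /= (@big_cat_nat _ _ _ n)//= big_mkord [X in _ + X]big1_seq ?addr0//.
move=> i /andP[_]; rewrite mem_index_iota => /andP[/an-> _].
by rewrite normc0 expr0n mul0r.
Qed.

Lemma sqnormD a b t : square_summable a -> square_summable b ->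
  sqnorm (a + t%:C *: b) = sqnorm a + 2 * t * rdot a b + t ^+ 2 * sqnorm b.
Proof.
move=> sa sb; have sab := is_cvg_rdot sa sb.
apply: cvg_lim => //; set s := series _.
have -> : s = series (fun n => normc (a n) ^+ 2 * w n)
    + (2 * t) *: series (fun n => cdot (a n) (b n) * w n)
    + t ^+ 2 *: series (fun n => normc (b n) ^+ 2 * w n).
  rewrite -!seriesZ -!seriesD; congr series; apply/funext => n.
  have expand (x y : R[i]) : normc (x + t%:C * y) ^+ 2 * w n =
      normc x ^+ 2 * w n + 2 * t * (cdot x y * w n) + t ^+ 2 * (normc y ^+ 2 * w n).
    by rewrite !normc_sqr /cdot; case: x y => [p q] [r u] /=; ring.
  exact: expand.
by apply: cvgD; [apply: cvgD => //|]; exact: cvgZl_tmp.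
Qed.

Lemma rdotDl a b u : square_summable a -> square_summable b -> square_summable u ->
  rdot (a + b) u = rdot a u + rdot b u.
Proof.
move=> sa sb su; apply: cvg_lim => //.
have -> : series (fun n => cdot ((a + b) n) (u n) * w n) =
    series (fun n => cdot (a n) (u n) * w n) + series (fun n => cdot (b n) (u n) * w n).
  rewrite -seriesD; congr series; apply/funext => n.
  have expand (x y v : R[i]) : cdot (x + y) v * w n = cdot x v * w n + cdot y v * w n.
    by rewrite /cdot; case: x y => [p q] [r s] /=; ring.
  exact: expand.
by apply: cvgD; exact: is_cvg_rdot.
Qed.

Lemma sqnormZ z a : square_summable a -> sqnorm (z *: a) = normc z ^+ 2 * sqnorm a.
Proof.
move=> sa; rewrite -[_ * _]/(_ *: _) /sqnorm -lim_seriesZ//.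
congr (limn (series _)); apply/funext => n.
by rewrite [X in normc X]/(z * a n) normcM exprMn -mulrA.
Qed.

Lemma le_sqnorm a n : square_summable a ->
  \sum_(i < n) normc (a i) ^+ 2 * w i <= sqnorm a.
Proof.
move=> sa; rewrite -(big_mkord xpredT (fun i => normc (a i) ^+ 2 * w i)).
apply: (nondecreasing_cvgn_le _ sa); apply/nondecreasing_seqP => k.
by rewrite [leRHS]seriesSr lerDl weighted_sq_ge0.
Qed.

Lemma sqnorm_ge0 a : square_summable a -> 0 <= sqnorm a.
Proof. by move=> sa; have := le_sqnorm 0 sa; rewrite big_ord0. Qed.

Lemma sqnorm_gt0 a : square_summable a -> a != 0 -> 0 < sqnorm a.
Proof.
move=> sa; apply: contraNT; rewrite -leNgt => a0; apply/eqP/funext => n.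
apply/eqP; rewrite -[_ == _]normc_eq0 -sqrf_eq0 -(mulrI_eq0 _ (lregP (lt0r_neq0 (w_gt0 n)))).
rewrite mulrC eq_le weighted_sq_ge0 andbT; apply: le_trans a0.
apply: le_trans (le_sqnorm n.+1 sa); rewrite big_ord_recr/= lerDr.
by apply: sumr_ge0 => i _; exact: weighted_sq_ge0.
Qed.

Lemma rdot_eq0 a b : square_summable a -> square_summable b ->
  (forall t, sqnorm a <= sqnorm (a + t%:C *: b)) -> rdot a b = 0.
Proof.
move=> sa sb ab; set p := rdot a b; set q := sqnorm b.
have q0 : 0 <= q by exact: sqnorm_ge0.
have pq t : 0 <= 2 * t * p + t ^+ 2 * q.
  by have := ab t; rewrite sqnormD// -addrA lerDl.
(* The minimizer of the quadratic would be [- p / q]; using [q + 1] avoids the case [q = 0] and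
   still gives a negative value unless [p = 0]. *)
have := pq (- p / (q + 1)).
have -> : 2 * (- p / (q + 1)) * p + (- p / (q + 1)) ^+ 2 * q =
    - (p ^+ 2 * (q + 2)) / (q + 1) ^+ 2 by field; rewrite gt_eqF//; lra.
rewrite pmulr_lge0 ?invr_gt0 ?exprn_gt0//; last by lra.
rewrite oppr_ge0 pmulr_lle0; last by lra.
by move=> p0; apply/eqP; rewrite -sqrf_eq0 eq_le p0 sqr_ge0.
Qed.

(** Phrased with finite sums so that it applies to sequences not yet known to be summable, such as
    the image of a vector under the matrix. *)
Lemma weighted_norm_le (a : nat -> C) (r : R) : 0 <= r ->
  (weighted_norm w a <= r%:E)%E <->
  forall n, \sum_(i < n) normc (a i) ^+ 2 * w i <= r ^+ 2.
Proof.
move=> r0; have -> : r%:E = sqrte ((r ^+ 2)%:E).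
  by rewrite /= sqrtr_sqr ger0_norm.
rewrite /weighted_norm lee_sqrt; last by rewrite lee_fin sqr_ge0.
have pos n : (0 <= (normc (a n) ^+ 2 * w n)%:E)%E by rewrite lee_fin weighted_sq_ge0.
split=> [ar n|ar].
  rewrite -lee_fin; apply: le_trans ar; rewrite -sumEFin -(big_mkord xpredT
    (fun i => (normc (a i) ^+ 2 * w i)%:E)).
  by apply: nneseries_lim_ge => k _ _; exact: pos.
apply: lime_le; first by apply: is_cvg_nneseries => n _ _; exact: pos.
by apply: nearW => n; rewrite sumEFin lee_fin big_mkord; exact: ar.
Qed.

Lemma weighted_norm_sqnorm a : square_summable a ->
  weighted_norm w a = (Num.sqrt (sqnorm a))%:E.
Proof.
move=> sa; rewrite /weighted_norm /sqnorm (_ : (\sum_(0 <= n <oo) _)%E = (sqnorm a)%:E)//.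
rewrite -EFin_lim//; congr (limn _); apply/funext => n /=.
by rewrite sumEFin.
Qed.

Lemma weighted_norm_lty a : (weighted_norm w a < +oo)%E -> square_summable a.
Proof.
move=> ar; apply: nnseries_is_cvg => [n|]; first exact: weighted_sq_ge0.
have X0 : (0 <= \sum_(0 <= n <oo) (normc (a n) ^+ 2 * w n)%:E)%E.
  by apply: nneseries_ge0 => n _ _; rewrite lee_fin weighted_sq_ge0.
rewrite -(sqr_sqrte X0); move: ar; rewrite -/(weighted_norm w a).
have : (0 <= weighted_norm w a)%E by exact: sqrte_ge0.
by case: (weighted_norm w a) => //= r _ _; exact: ltry.
Qed.

Lemma weighted_norm_leP a b : square_summable a -> square_summable b ->
  (weighted_norm w a <= weighted_norm w b)%E = (sqnorm a <= sqnorm b).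
Proof.
move=> sa sb; rewrite !weighted_norm_sqnorm// lee_fin ler_sqrt//.
exact: sqnorm_ge0.
Qed.

Lemma Re_dot a b : square_summable a -> square_summable b ->
  Re (limn (series (fun n => a n * (b n)^* * (w n)%:C : C))) = rdot a b.
Proof.
(* The imaginary part of the complex pairing is the real pairing with ['i *: b]. *)
move=> sa sb; have sib := square_summableZ (z := 'i) sb.
suff h : series (fun n => a n * (b n)^* * (w n)%:C : C) @ \oo -->
    (rdot a b +i* rdot a ('i *: b) : C).
  by rewrite (cvg_lim (@norm_hausdorff _ C) h).
apply/cvgn_complexP => e e0; have e2 : 0 < e / 2 by lra.
have /cvgrPdist_lt/(_ _ e2) hr := is_cvg_rdot sa sb.
have /cvgrPdist_lt/(_ _ e2) hi := is_cvg_rdot sa sib.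
near=> n.
have -> : series (fun n => a n * (b n)^* * (w n)%:C : C) n =
    series (fun n => cdot (a n) (b n) * w n) n +i*
    series (fun n => cdot (a n) (('i *: b) n) * w n) n :> R[i].
  apply/eqP; rewrite eq_complex /series /= Re_sum Im_sum; apply/andP; split.
    apply/eqP; apply: eq_bigr => i _; rewrite /cdot.
    by case: (a i) (b i) => p q [r s] /=; ring.
  apply/eqP; apply: eq_bigr => i _; rewrite /cdot -[('i *: b) i]/('i * b i).
  by case: (a i) (b i) => p q [r s] /=; ring.
apply: le_lt_trans (normc_leRI _) _; rewrite /= [ltRHS]splitr ltrD//.
  by near: n.
by near: n.
Unshelve. all: by end_near. Qed.

End WeightedSquareSummable.

(** * Jacobi matrices *)

#[local] Arguments normc : simpl never.

Section JacobiForm.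
Variables (R : realType) (c : nat -> R).
Implicit Types (x y : nat -> R) (r : R) (N : nat).

(** The left side is the quadratic form of the symmetric Jacobi matrix with off-diagonal entries
    [c], cut to its first [N.+1] coordinates. A one-sided bound on finite real vectors is what both
    directions of the theorem handle directly. *)
Definition jacobi_form_le r : Prop := forall N x,
  2 * \sum_(n < N) c n * (x n * x n.+1) <= r * \sum_(n < N.+1) x n ^+ 2.

Definition jacobi_apply x : nat -> R :=
  fun n => c n * x n.+1 + (if n is m.+1 then c m * x m else 0).

Lemma jacobi_applyE x y N : x N.+1 = 0 ->
  \sum_(n < N.+1) y n * jacobi_apply x n =
  \sum_(n < N) c n * (y n * x n.+1 + y n.+1 * x n).
Proof.
move=> xN; under eq_bigr do rewrite mulrDr; rewrite big_split/=.
rewrite big_ord_recr/= xN !mulr0 addr0 [X in _ + X]big_ord_recl/= mulr0 add0r.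
by rewrite -big_split/=; apply: eq_bigr => i _ /=; ring.
Qed.

(* Flipping the signs of the odd coordinates negates the form, so the one-sided
   bound also controls [x - y] in the polarization identity. *)
Lemma jacobi_form_polar r x y N : jacobi_form_le r ->
  2 * \sum_(n < N) c n * (y n * x n.+1 + y n.+1 * x n) <=
  r * (\sum_(n < N.+1) x n ^+ 2 + \sum_(n < N.+1) y n ^+ 2).
Proof.
move=> cr; have h1 := cr N (fun n => x n + y n).
have h2 := cr N (fun n => (-1) ^+ n * (x n - y n)).
have e1 : \sum_(n < N) c n * ((x n + y n) * (x n.+1 + y n.+1)) +
    \sum_(n < N) c n * ((-1) ^+ n * (x n - y n) * ((-1) ^+ n.+1 * (x n.+1 - y n.+1))) =
    2 * \sum_(n < N) c n * (y n * x n.+1 + y n.+1 * x n).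
  rewrite -big_split mulr_sumr; apply: eq_bigr => i _ /=.
  rewrite [(-1) ^+ i.+1]exprS; have := sqrr_sign R i; rewrite expr2.
  move: ((-1) ^+ i) => s s2.
  have -> : s * (x i - y i) * (-1 * s * (x i.+1 - y i.+1)) =
    - (s * s) * ((x i - y i) * (x i.+1 - y i.+1)) by ring.
  by rewrite s2; ring.
have e2 : \sum_(n < N.+1) (x n + y n) ^+ 2 +
    \sum_(n < N.+1) ((-1) ^+ n * (x n - y n)) ^+ 2 =
    2 * (\sum_(n < N.+1) x n ^+ 2 + \sum_(n < N.+1) y n ^+ 2).
  rewrite -!big_split mulr_sumr; apply: eq_bigr => i _ /=.
  by rewrite exprMn sqrr_sign; ring.
have := lerD h1 h2; rewrite -!mulrDr e1 e2.
by rewrite mulrCA [leRHS]mulrCA ler_pM2l.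
Qed.

(** With [J] the matrix, polarization applied to [y = r^-1 J x] reads [2 r^-1 ||J x||^2 <= r
    (||x||^2 + r^-2 ||J x||^2)], which rearranges to the claim. This is the passage from the
    quadratic form to the norm of a symmetric operator. *)
Lemma jacobi_apply_le r x N : 0 < r -> jacobi_form_le r -> x N.+1 = 0 ->
  \sum_(n < N.+1) jacobi_apply x n ^+ 2 <= r ^+ 2 * \sum_(n < N.+1) x n ^+ 2.
Proof.
move=> r0 cr xN; pose y n := r^-1 * jacobi_apply x n.
have := jacobi_form_polar x y N cr; rewrite -jacobi_applyE// /y.
have -> : \sum_(n < N.+1) r^-1 * jacobi_apply x n * jacobi_apply x n =
    r^-1 * \sum_(n < N.+1) jacobi_apply x n ^+ 2.
  by rewrite mulr_sumr; apply: eq_bigr => i _; rewrite -mulrA.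
have -> : \sum_(n < N.+1) (r^-1 * jacobi_apply x n) ^+ 2 =
    r^-1 ^+ 2 * \sum_(n < N.+1) jacobi_apply x n ^+ 2.
  by rewrite mulr_sumr; apply: eq_bigr => i _; rewrite exprMn.
move: (\sum_(_ < _) _ ^+ 2) (\sum_(_ < _) _ ^+ 2) => J D.
rewrite -(ler_pM2l r0) => h.
have e1 : r * (2 * (r^-1 * D)) = 2 * D by field; rewrite gt_eqF.
have e2 : r * (r * (J + r^-1 ^+ 2 * D)) = r ^+ 2 * J + D by field; rewrite gt_eqF.
by move: h; rewrite e1 e2; lra.
Qed.

(** Each product [2 x_n x_(n+1)] is at most [x_n^2 + x_(n+1)^2], and every square is used at most
    twice; a factor in [[0, 1]] can only help when the product is positive. *)
Lemma jacobi_form_le2 : (forall n, 0 <= c n <= 1) -> jacobi_form_le 2.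
Proof.
move=> c1 N x; rewrite ler_pM2l//.
apply: (@le_trans _ _ (\sum_(n < N) (x n ^+ 2 / 2 + x n.+1 ^+ 2 / 2))).
  apply: ler_sum => i _; have /andP[c0 ci] := c1 i.
  have h1 := sqr_ge0 (x i - x i.+1); have h2 := sqr_ge0 (x i + x i.+1).
  have [xx|xx] := leP 0 (x i * x i.+1).
    by apply: (@le_trans _ _ (x i * x i.+1)); [rewrite ler_piMl|lra].
  by apply: (@le_trans _ _ 0); [rewrite mulr_ge0_le0// ltW|lra].
rewrite big_split/=; set S := \sum_(n < N.+1) _.
have S1 : \sum_(n < N) x n ^+ 2 / 2 <= S / 2.
  by rewrite /S big_ord_recr/= -mulr_suml ler_pM2r// lerDl sqr_ge0.
have S2 : \sum_(n < N) x n.+1 ^+ 2 / 2 <= S / 2.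
  by rewrite /S big_ord_recl/= -mulr_suml ler_pM2r// lerDr sqr_ge0.
by rewrite [leRHS]splitr lerD.
Qed.

(** Test on the indicator of [[K, K + m]], where [c] exceeds [(2 + r) / 4] from [K] on: there are
    [m] products but [m + 1] squares, so [(2 - r) / 2 * m <= r] for every [m], impossible if
    [r < 2]. *)
Lemma jacobi_form_ge2 r : c @ \oo --> (1 : R) -> jacobi_form_le r -> 2 <= r.
Proof.
move=> c1 cr; rewrite leNgt; apply/negP => r2.
have e0 : 0 < (2 - r) / 4 by lra.
have /cvgrPdist_lt/(_ _ e0)[K _ cK] := c1.
have cq n : (K <= n)%N -> (2 + r) / 4 <= c n.
  by move=> /cK /=; rewrite ltr_distl => /andP[]; lra.
have h m : (2 + r) / 2 * m%:R <= r * (m%:R + 1).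
  have := cr (K + m)%N (fun n => (K <= n)%:R).
  have -> : \sum_(n < (K + m).+1) ((K <= n)%:R : R) ^+ 2 = m%:R + 1.
    rewrite -(big_mkord xpredT (fun n => ((K <= n)%:R : R) ^+ 2)).
    rewrite (@big_cat_nat _ _ _ K)//=; last by rewrite leqW ?leq_addr.
    rewrite big1_seq ?add0r; last first.
      move=> i /andP[_]; rewrite mem_index_iota => /andP[_]; rewrite ltnNge => /negPf->.
      by rewrite expr0n.
    rewrite (eq_big_nat _ _ (F2 := fun=> 1)); last first.
      by move=> i /andP[-> _]; rewrite expr1n.
    by rewrite sumr_const_nat -addnS addKn natr1.
  apply: le_trans; have -> : (2 + r) / 2 * m%:R = 2 * ((2 + r) / 4 * m%:R) :> R by field.
  rewrite ler_pM2l// -(big_mkord xpredT (fun n => c n * ((K <= n)%:R * (K <= n.+1)%:R))).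
  rewrite (@big_cat_nat _ _ _ K)//= ?leq_addr// big1_seq ?add0r; last first.
    move=> i /andP[_]; rewrite mem_index_iota => /andP[_]; rewrite ltnNge => /negPf->.
    by rewrite mul0r mulr0.
  apply: (@le_trans _ _ (\sum_(K <= i < K + m) ((2 + r) / 4))).
    by rewrite sumr_const_nat addKn mulr_natr.
  apply: ler_sum_nat => i /andP[Ki _]; rewrite Ki (leqW Ki) !mulr1.
  exact: cq.
have := archi_boundP (_ : 0 <= `|r| / ((2 - r) / 2)); set m := Num.bound _ => mr.
have {mr} : `|r| / ((2 - r) / 2) < m%:R by apply: mr; rewrite divr_ge0//; lra.
rewrite ltr_pdivrMr; last by lra.
have := h m; have := ler_norm r; lra.
Qed.

End JacobiForm.

(** * The operator norm of the Jacobi matrix and its quadratic form *)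

Section JacobiNorm.
Variable R : realType.
Local Notation C := (R[i]^o).
Variable w : nat -> R.

Definition jacobi_weight (n : nat) : R := Num.sqrt (w n.+1 / w n.+2).
Local Notation c := jacobi_weight.

Lemma matrix_apply_jacobi (x : nat -> C) j :
  matrix_apply (jacobi w) x j =
  (c j)%:C * x j.+1 + (if j is i.+1 then (c i)%:C * x i else 0).
Proof.
apply: (cvg_lim (@norm_hausdorff _ C)).
apply: cvg_near_cst; exists j.+2 => // m /= jm.
rewrite /series /= (@big_cat_nat _ _ _ j.+2)//= [X in _ + X]big1_seq ?addr0; last first.
  move=> k /andP[_]; rewrite mem_index_iota => /andP[jk _].
  by rewrite /jacobi !eqSS gtn_eqF ?ltn_eqF ?mul0r// ltnW// ltnW.
rewrite big_nat_recr//= addrC; congr (_ + _); first by rewrite /jacobi eqxx.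
rewrite big_nat_recr//= {2}/jacobi ltn_eqF// mul0r addr0.
case: j jm => [|j] _; first by rewrite big_geq.
rewrite big_nat_recr//= big1_seq ?add0r.
  by rewrite /jacobi ltn_eqF ?eqxx// ltnW.
move=> k /andP[_]; rewrite mem_index_iota => /andP[_ kj].
by rewrite /jacobi !eqSS ltn_eqF ?gtn_eqF ?mul0r// ltnW// ltnW.
Qed.

(** From form to norm, nonnegative entries give [|J x| <= J |x|] coordinatewise, which reduces
    complex vectors to real ones. From norm to form, a truncated vector is normalized and the
    Cauchy-Schwarz inequality is used in additive form. *)
Lemma l2_opnorm_leP r : 0 < r ->
  (l2_opnorm (jacobi w) <= r%:E)%E <-> jacobi_form_le c r.
Proof.
move=> r0; have one_gt0 (n : nat) : 0 < (1 : R) by [].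
split=> [Jr N x|cr]; last first.
  apply: ge_ereal_sup => _ [x x1 <-]; apply/weighted_norm_le => //; first exact: ltW.
  (* Coordinates below [M] of the image involve [x] only up to index [M], so truncating there loses
     nothing. *)
  move=> M; pose y n := if (n <= M)%N then normc (x n) else 0.
  have y1 : \sum_(n < M.+1) y n ^+ 2 <= 1.
    move/(weighted_norm_le one_gt0 _ ler01)/(_ M.+1) : x1; rewrite expr1n.
    apply: le_trans; apply: ler_sum => i _.
    by rewrite /y -ltnS ltn_ord mulr1.
  have yM : y M.+1 = 0 by rewrite /y ltnn.
  have := jacobi_apply_le r0 cr yM => h.
  apply: (le_trans _ (le_trans h _)); last by rewrite ler_piMr ?sqr_ge0.
  rewrite [leRHS]big_ord_recr/=; apply: ler_wpDr; first exact: sqr_ge0.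
  apply: ler_sum => i _; rewrite mulr1.
  have xy : normc (matrix_apply (jacobi w) x i) <= jacobi_apply c y i.
    rewrite matrix_apply_jacobi; apply: (le_trans (le_normcD _ _)).
    rewrite normcM normc_real ger0_norm ?sqrtr_ge0// /jacobi_apply /y ltn_ord lerD2l.
    case: i => -[|i] /= iM; first by rewrite normc0.
    by rewrite [leLHS](normcM (c i)%:C (x i)) normc_real ger0_norm ?sqrtr_ge0// (ltnW (ltnW iM)).
  by rewrite ler_sqr ?nnegrE ?normc_ge0// (le_trans _ xy) ?normc_ge0.
set s := \sum_(n < N.+1) x n ^+ 2; pose y n := if (n <= N)%N then x n else 0.
have s0 : 0 <= s by apply: sumr_ge0 => i _; exact: sqr_ge0.
have yN : y N.+1 = 0 by rewrite /y ltnn.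
(* Dividing by [s + e] rather than [s] covers the zero vector; [e] is arbitrary and disappears at
   the end. *)
have Jy e : 0 < e -> \sum_(n < N.+1) jacobi_apply c y n ^+ 2 <= r ^+ 2 * (s + e).
  move=> e0; set t := Num.sqrt (s + e)^-1; have se : 0 < s + e by rewrite ltr_wpDl.
  have t2 : t ^+ 2 = (s + e)^-1 by rewrite sqr_sqrtr// invr_ge0 ltW.
  pose v n : C := (t * y n)%:C.
  have v1 : (l2norm v <= 1)%E.
    apply/(weighted_norm_le one_gt0 _ ler01) => M; rewrite expr1n.
    apply: (@le_trans _ _ (\sum_(n < M + N.+1) (t * y n) ^+ 2)).
      rewrite big_split_ord/= ler_wpDr// ?sumr_ge0// => [i _|]; first exact: sqr_ge0.
      by apply: ler_sum => i _; rewrite mulr1 /v normc_real real_normK ?num_real.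
    rewrite addnC big_split_ord/= [X in _ + X]big1 ?addr0; last first.
      by move=> i _; rewrite /y leqNgt ltnS leq_addr /= mulr0 expr0n.
    rewrite (eq_bigr (fun n : 'I_N.+1 => t ^+ 2 * x n ^+ 2)); last first.
      by move=> i _; rewrite /y -ltnS ltn_ord exprMn.
    by rewrite -mulr_sumr -/s t2 mulrC ler_pdivrMr// mul1r lerDl ltW.
  have : (l2norm (matrix_apply (jacobi w) v) <= r%:E)%E.
    by apply: le_trans Jr; apply: ereal_sup_ubound; exists v.
  move/(weighted_norm_le one_gt0 _ (ltW r0))/(_ N.+1).
  rewrite (eq_bigr (fun n : 'I_N.+1 => t ^+ 2 * jacobi_apply c y n ^+ 2)); last first.
    move=> i _; rewrite mulr1 matrix_apply_jacobi -exprMn.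
    rewrite -[RHS]real_normK ?num_real// -normc_real; congr (normc _ ^+ 2).
    rewrite /jacobi_apply /v mulrDr !rmorphD/= !rmorphM/=; congr (_ + _).
      by rewrite mulrCA.
    by case: (nat_of_ord i) => [|k]; rewrite ?mulr0// !rmorphM/= mulrCA.
  by rewrite -mulr_sumr t2 mulrC ler_pdivrMr.
have Qy : 2 * \sum_(n < N) c n * (x n * x n.+1) = \sum_(n < N.+1) y n * jacobi_apply c y n.
  rewrite jacobi_applyE// mulr_sumr; apply: eq_bigr => i _.
  by rewrite /y (ltnW (ltn_ord i)) ltn_ord; ring.
apply/ler_addgt0Pr => e e0; rewrite Qy.
have e1 : 0 < e / r by rewrite divr_gt0.
(* The termwise bound expands [(r x - J)^2 >= 0]. Its weights are those for which
   [||J||^2 <= r^2 (s + e / r)] leads to [r s + e / 2]. *)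
apply: (@le_trans _ _ (\sum_(n < N.+1) (r / 2 * x n ^+ 2 + r^-1 / 2 * jacobi_apply c y n ^+ 2))).
  apply: ler_sum => i _; rewrite {1}/y -ltnS ltn_ord; set J := jacobi_apply c y i.
  have := sqr_ge0 (r * x i - J); rewrite -(pmulr_rge0 _ (_ : 0 < (2 * r)^-1)); last first.
    by rewrite invr_gt0 mulr_gt0.
  have -> : (2 * r)^-1 * (r * x i - J) ^+ 2 =
     r / 2 * x i ^+ 2 + r^-1 / 2 * J ^+ 2 - x i * J by field; rewrite gt_eqF.
  by rewrite subr_ge0.
rewrite big_split/= -!mulr_sumr -/s.
have := Jy _ e1; rewrite -(ler_pM2l (_ : 0 < r^-1 / 2)); last by rewrite divr_gt0 ?invr_gt0.
have -> : r^-1 / 2 * (r ^+ 2 * (s + e / r)) = r / 2 * s + e / 2 by field; rewrite gt_eqF.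
by clear -e0; move: (r^-1 / 2 * _) => J; lra.
Qed.

End JacobiNorm.

(** * Zeros of optimal approximants *)

Section OrthogonalZero.
Variable R : realType.
Local Notation C := (R[i]^o).
Variable w : nat -> R.
Hypothesis w_adm : admissible_weight w.
Implicit Types (a b g : nat -> C) (f : C -> C) (p q : {poly R[i]}) (z : C).

Let w_gt0 n : 0 < w n. Proof. by case: w_adm. Qed.

(** The ratios [w n.+1 / w n] are below 2 from some [N] on, and the finitely many earlier ones are
    absorbed by adding their sum. This is boundedness of the shift. *)
Lemma admissible_weight_bound : exists2 M : R, 0 <= M & forall n, w n.+1 <= M * w n.
Proof.
case: w_adm => _ _ w1; have half : (0 : R) < 2^-1 by [].
have /cvgrPdist_lt/(_ _ half)[N _ wN] := w1.
exists (2 + \sum_(i < N) w i.+1 / w i).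
  by rewrite addr_ge0// sumr_ge0// => i _; rewrite divr_ge0// ltW.
move=> n; rewrite -ler_pdivrMr//; have [Nn|nN] := leqP N n.
  have : 2^-1 < w n / w n.+1.
    by have /= := wN _ Nn; rewrite ltr_distl => /andP[]; lra.
  rewrite -[X in X < _]/(2^-1) -(ltf_pV2) ?posrE ?divr_gt0// invrK invf_div => /ltW.
  move/le_trans; apply; rewrite lerDl sumr_ge0// => i _.
  by rewrite divr_ge0// ltW.
rewrite (bigD1 (Ordinal nN))//= addrCA lerDl addr_ge0// sumr_ge0// => i _.
by rewrite divr_ge0// ltW.
Qed.

Lemma series_shift a n :
  series (fun n => normc (shift a n) ^+ 2 * w n) n.+1 =
  series (fun n => normc (a n) ^+ 2 * w n.+1) n.
Proof.
by rewrite /series /= big_nat_recl//= normc0 expr0n mul0r add0r.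
Qed.

Lemma square_summable_shift a : square_summable w a -> square_summable w (shift a).
Proof.
have [M M0 wM] := admissible_weight_bound.
move=> sa; have h : cvgn (series (fun n => normc (a n) ^+ 2 * w n.+1)).
  apply: series_le_cvg (is_cvg_seriesZ (k := M) sa) => n.
  - by rewrite mulr_ge0 ?sqr_ge0// ltW.
  - by rewrite mulr_ge0// mulr_ge0 ?sqr_ge0// ltW.
  - by rewrite -[leRHS]/(M * (normc (a n) ^+ 2 * w n)) mulrCA ler_wpM2l ?sqr_ge0.
apply: (cvgP (limn (series (fun n => normc (a n) ^+ 2 * w n.+1)))).
by rewrite -(cvg_shiftS _) (funext (series_shift a)).
Qed.

Lemma square_summable_conv p a : square_summable w a -> square_summable w (conv p a).
Proof.
move=> sa; elim/poly_ind: p => [|p c IHp].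
  by rewrite conv0; apply: (square_summable_finite (n := 0%N)).
rewrite convD convMX convC; apply: square_summableD => //.
  exact: square_summable_shift.
exact: square_summableZ.
Qed.

Lemma sqnorm_le_shift a : (forall n, w n <= w n.+1) -> square_summable w a ->
  sqnorm w a <= sqnorm w (shift a).
Proof.
move=> ww sa; apply: limr_le => //; apply: nearW => n.
rewrite /series /= big_mkord.
apply: le_trans (le_sqnorm w_gt0 n.+1 (square_summable_shift sa)).
rewrite big_ord_recl/= normc0 expr0n mul0r add0r.
by apply: ler_sum => i _; rewrite ler_wpM2l ?sqr_ge0.
Qed.

Lemma H2P f : H2 w f <-> exists a, expands_as f a /\ square_summable w a.
Proof.
split=> [[[a fa]]|[a [fa sa]]].
  by rewrite /H2norm (coefsE fa) => /(weighted_norm_lty w_gt0) sa; exists a; split=> //; exact: sa.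
by split; [exists a|rewrite /H2norm (coefsE fa) weighted_norm_sqnorm// ltry].
Qed.

Definition unit_seq : nat -> C := fun n => (n == 0%N)%:R.

Lemma square_summable_unit : square_summable w unit_seq.
Proof. by apply: (square_summable_finite (n := 1%N)) => -[]. Qed.

Lemma expands_as_sub1 f a : expands_as f a ->
  expands_as (fun z => (f z - 1)%R) (a - unit_seq).
Proof.
move=> fa; have h : expands_as (fun z : C => \sum_(i < 1) unit_seq i * z ^+ i) unit_seq.
  by apply: expands_as_finite => -[].
have E : (fun z : C => (f z - 1)%R) = (fun z => f z - \sum_(i < 1) unit_seq i * z ^+ i).
  by apply/funext => z; rewrite big_ord1 /unit_seq eqxx mul1r expr0.
by rewrite E; exact: expands_asB.
Qed.

Lemma rdot_unit a : rdot w (- unit_seq) a = - Re (a 0%N) * w 0%N.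
Proof.
apply: cvg_lim => //; apply: cvg_near_cst; exists 1%N => // n /= n0.
rewrite /series /= big_ltn// big1_seq ?addr0.
  by rewrite /cdot /unit_seq /=; ring.
move=> [|i] /andP[_]; rewrite mem_index_iota//= => _.
by rewrite /cdot /unit_seq /=; ring.
Qed.

Lemma eq_rdot a b a' b' :
  (forall n, cdot (a n) (b n) = cdot (a' n) (b' n)) -> rdot w a b = rdot w a' b'.
Proof. by move=> h; congr (limn (series _)); apply/funext => n; rewrite h. Qed.

Lemma optimal_approximant_rdot f a n p q : expands_as f a -> square_summable w a ->
  optimal_approximant w f n p -> (size q <= n.+1)%N ->
  rdot w (conv p a - unit_seq) (conv q a) = 0.
Proof.
move=> fa sa [sp hp] sq.
have sE r : square_summable w (conv r a - unit_seq).
  rewrite -scaleN1r; apply: square_summableD => //; first exact: square_summable_conv.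
  by apply: square_summableZ => //; exact: square_summable_unit.
apply: rdot_eq0 => //; first exact: square_summable_conv.
move=> t; have sq' : (size (p + t%:C *: q)%R <= n.+1)%N.
  rewrite (leq_trans (size_polyD _ _))// geq_max sp.
  by rewrite (leq_trans (size_scale_leq _ _)).
have := hp _ sq'; rewrite /H2norm.
rewrite !(coefsE (expands_as_sub1 (expands_as_polymul fa))).
by rewrite weighted_norm_leP// convD convZ addrAC.
Qed.

(* [g] is the coefficient sequence of [q f], where [(X - z) q] is the approximant. *)
Definition orthogonal_zero z : Prop := exists g,
  [/\ square_summable w g, g != 0 & rdot w (shift g - z *: g) (shift g) = 0].

Lemma conv_XsubC z q a : conv (q * ('X - z%:P)) a = shift (conv q a) - z *: conv q a.
Proof. by rewrite mulrBr [q * z%:P]mulrC mul_polyC convB convMX convZ. Qed.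

Lemma optimal_approximant_neq0 f a n p : expands_as f a -> square_summable w a ->
  a 0%N != 0 -> optimal_approximant w f n p -> p != 0.
Proof.
move=> fa sa a0 op; apply/eqP => p0.
(* The direction [conj (a 0)] is chosen because, if [p = 0], its pairing with the residual [-1] is
   [- |a 0|^2 w 0], which is not zero. *)
have sc : (size ((a 0%N)^*%C%:P) <= n.+1)%N by rewrite (leq_trans (size_polyC_leq1 _)).
have := optimal_approximant_rdot fa sa op sc.
rewrite p0 conv0 sub0r rdot_unit convC => /eqP.
rewrite mulf_eq0 (gt_eqF (w_gt0 0)) orbF oppr_eq0.
rewrite -[(_ *: a) 0%N]/((a 0%N)^*%C * a 0%N) mulrC.
have -> : Re (a 0%N * (a 0%N)^*%C) = normc (a 0%N) ^+ 2.
  by rewrite normc_sqr; case: (a 0%N) => x y /=; ring.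
by rewrite sqrf_eq0 normc_eq0 (negPf a0).
Qed.

Lemma approximant_orthogonal_zero z : approximant_zero w z -> orthogonal_zero z.
Proof.
move=> [f [n [p [/H2P[a [fa sa]] f0 op pz]]]]; have [sp _] := op.
have a0 : a 0%N != 0 by rewrite -(expands_as0 fa).
have p0 := optimal_approximant_neq0 fa sa a0 op.
have /factor_theorem[q pq] := pz.
have q0 : q != 0 by apply: contraNneq p0 => q0; rewrite pq q0 mul0r.
(* Replacing the factor [X - z] by [X] keeps the degree, so [q * 'X] is an allowed direction of
   variation. *)
have sq : (size (q * 'X)%R <= n.+1)%N.
  by apply: leq_trans sp; rewrite pq size_mulX// size_Mmonic ?monicXsubC// size_XsubC addn2.
exists (conv q a); split; [exact: square_summable_conv|exact: conv_neq0|].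
rewrite -(optimal_approximant_rdot fa sa op sq) convMX -conv_XsubC -pq.
(* The constant 1 in the residual lives at index 0, where the shifted sequence vanishes, so it drops
   out of the pairing. *)
apply: eq_rdot => -[|k] /=; first by rewrite /cdot !mulr0.
by rewrite -[(conv p a - unit_seq) k.+1]/(conv p a k.+1 - 0) subr0.
Qed.

Lemma rdotC a b : rdot w a b = rdot w b a.
Proof.
congr (limn (series _)); apply/funext => n.
by rewrite /cdot mulrC [Re _ * _]mulrC [Im _ * _]mulrC [_ * w n]mulrC.
Qed.

Lemma Re_H2dot f a p q : expands_as f a -> square_summable w a ->
  Re (H2dot w (polymul p f) (polymul q f)) = rdot w (conv p a) (conv q a).
Proof.
move=> fa sa; rewrite /H2dot !(coefsE (expands_as_polymul fa)).
by rewrite (Re_dot w_gt0)//; exact: square_summable_conv.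
Qed.

Lemma orthogonal_zero_gt1 z : (forall n, w n <= w n.+1) -> orthogonal_zero z -> 1 < `|z|.
Proof.
move=> ww [g [sg g0 gz]]; have sS := square_summable_shift sg.
have sB : square_summable w (shift g - z *: g).
  rewrite -scaleNr; apply: square_summableD => //; exact: square_summableZ.
(* Strictness rests on the shift having no eigenvector: [shift g = z *: g] forces [z g_0 = 0] and
   [z g_(n+1) = g_n], hence [g = 0]. *)
have B0 : shift g - z *: g != 0.
  apply: contra g0 => /eqP/subr0_eq Sg; apply/eqP/funext => n.
  have Sn k : shift g k = z * g k by rewrite Sg.
  have [z0|z0] := eqVneq z 0; first by have := Sn n.+1; rewrite z0 mul0r.
  apply/eqP; rewrite -[_ == _]orFb -(negPf z0) -mulf_eq0.
  by elim: n => [|n IHn]; rewrite -Sn//= -[_ == _]orFb -(negPf z0) -mulf_eq0.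
have : sqnorm w (z *: g) = sqnorm w (shift g) + sqnorm w (shift g - z *: g).
  rewrite [in LHS](_ : z *: g = shift g + (-1)%:C *: (shift g - z *: g)).
    by rewrite sqnormD// rdotC gz; ring.
  by rewrite rmorphN1 scaleN1r subKr.
rewrite sqnormZ// => gS; have := sqnorm_gt0 w_gt0 sB B0.
have := sqnorm_le_shift ww sg; have := sqnorm_gt0 w_gt0 sg g0.
rewrite normE ltcR => G0 GS B1; rewrite ltNge; apply/negP => z1.
have : normc z ^+ 2 * sqnorm w g <= sqnorm w g.
  by rewrite ler_piMl ?(ltW G0)// exprn_ile1// normc_ge0.
lra.
Qed.

Lemma cdot_le (x y : R[i]) : cdot x y <= normc x * normc y.
Proof.
have -> : cdot x y = Re (x * y^*%C) by rewrite /cdot; case: x y => p q [r s] /=; ring.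
have yE : normc y = normc (y^*%C) by case: y => r s; rewrite /normc /= sqrrN.
rewrite yE -normcM; case: (x * _) => p q.
apply: (le_trans (ler_norm _)); rewrite /normc/= -sqrtr_sqr ler_wsqrtr// lerDl.
exact: sqr_ge0.
Qed.

Lemma orthogonal_zero_ge1 z : jacobi_form_le (jacobi_weight w) 2 ->
  orthogonal_zero z -> 1 <= `|z|.
Proof.
move=> cw [g [sg g0 gz]]; have sS := square_summable_shift sg.
rewrite normE lecR leNgt; apply/negP => z1.
have A0 : 0 < sqnorm w (shift g).
  apply: sqnorm_gt0 => //; apply: contra g0 => /eqP Sg; apply/eqP/funext => n.
  exact: (congr1 (@^~ n.+1) Sg).
have partial N : \sum_(n < N) normc (g n.+1) * normc (g n) * w n.+1 <= sqnorm w (shift g).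
  have := cw N (fun n => normc (g n) * Num.sqrt (w n.+1)); rewrite ler_pM2l//.
  rewrite (eq_bigr (fun n : 'I_N => normc (g n.+1) * normc (g n) * w n.+1)); last first.
    move=> i _; rewrite /jacobi_weight sqrtrM ?(ltW (w_gt0 _))// sqrtrV ?(ltW (w_gt0 _))//.
    rewrite -[in RHS](sqr_sqrtr (ltW (w_gt0 i.+1))).
    by field; rewrite sqrtr_eq0 -ltNge.
  move/le_trans; apply; apply: le_trans (le_sqnorm w_gt0 N.+2 sS).
  rewrite [leRHS]big_ord_recl/= normc0 expr0n mul0r add0r.
  by apply: ler_sum => i _; rewrite exprMn sqr_sqrtr// ltW.
set A := sqnorm w (shift g) in A0 partial *.
have sB : square_summable w (shift g - z *: g).
  rewrite -scaleNr; apply: square_summableD => //; exact: square_summableZ.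
have cT := is_cvg_rdot w_gt0 sB sS; rewrite /rdot in gz.
have := cvgB cT sS; rewrite [X in _ --> X - _]gz sub0r => /(_ eventually_filter) cTP.
(* The partial sums of the vanishing pairing minus those of [A] tend to [- A]. Their terms are
   [- Re (z g_(i+1) conj(g_i)) w_(i+1)], so by [partial] they stay above [- |z| A]; hence
   [A <= |z| A], against [|z| < 1]. *)
have : - (normc z * A) <= - A.
  rewrite -(cvg_lim _ cTP)//; apply: limr_ge; first exact: cvgP cTP.
  exists 1%N => // -[//|N] _.
  rewrite [leRHS](_ : _ = - \sum_(i < N) cdot (z * g i.+1) (g i) * w i.+1); last first.
    rewrite /series -[LHS]/(\sum_(0 <= k < N.+1) _ - \sum_(0 <= k < N.+1) _) -sumrB.
    rewrite big_mkord big_ord_recl/= -sumrN normc0 expr0n /cdot /= !mulr0 addr0 !mul0r subr0 add0r.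
    apply: eq_bigr => i _; rewrite normc_sqr.
    rewrite -[(shift g - z *: g) _]/(g i - z * g i.+1).
    by case: (g i) (z * g i.+1) => p q [r s] /=; ring.
  rewrite lerN2; apply: le_trans (ler_wpM2l (normc_ge0 z) (partial N)).
  rewrite mulr_sumr; apply: ler_sum => i _; rewrite !mulrA -normcM.
  by rewrite ler_wpM2r ?(ltW (w_gt0 _))// cdot_le.
rewrite lerN2; nra.
Qed.

End OrthogonalZero.

(** * From reproducing kernels to optimal approximants *)

Section KernelToApproximant.
Variable R : realType.
Local Notation C := (R[i]^o).
Variable w : nat -> R.
Hypothesis w_adm : admissible_weight w.
Implicit Types (a b g : nat -> C) (f : C -> C) (p q : {poly R[i]}) (z : C).

Let w_gt0 n : 0 < w n. Proof. by case: w_adm. Qed.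

Lemma rdot_conjZ (c : R[i]) a b : rdot w a (c *: b) = rdot w (c^*%C *: a) b.
Proof.
congr (limn (series _)); apply/funext => n; congr (_ * _).
have adj (x y : R[i]) : cdot x (c * y) = cdot (c^*%C * x) y.
  by rewrite /cdot; case: x y c => [p q] [r s] [t u] /=; ring.
exact: adj.
Qed.

(** For [h] of degree at most [n], the reproducing property at 0 gives [<h f, p f> = f(0) h(0)],
    which is [<h f, 1>] since [w 0 = 1]. The residual [p f - 1] is thus orthogonal to all competing
    increments, and Pythagoras gives minimality. *)
Lemma kernel_optimal_approximant f a n K : expands_as f a -> square_summable w a ->
  weighted_kernel w f n K -> optimal_approximant w f n ((a 0%N)^*%C *: K 0).
Proof.
move=> fa sa kK; have [sK rK] := kK 0; set p := _ *: _.
have sp : (size p <= n.+1)%N by rewrite (leq_trans (size_scale_leq _ _)).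
split=> [|q sq]; first exact: sp.
rewrite /H2norm.
rewrite !(coefsE (expands_as_sub1 (expands_as_polymul fa))).
have su : square_summable w (- unit_seq R).
  by rewrite -scaleN1r; apply: square_summableZ => //; exact: square_summable_unit.
have sC r : square_summable w (conv r a) by exact: square_summable_conv.
have sCu r : square_summable w (conv r a - unit_seq R) by exact: square_summableD.
rewrite weighted_norm_leP//.
have -> : conv q a - unit_seq R = conv p a - unit_seq R + 1%:C *: conv (q - p) a.
  by rewrite scale1r convB addrAC subrKC.
rewrite sqnormD//.
have -> : rdot w (conv p a - unit_seq R) (conv (q - p) a) = 0.
  rewrite rdotDl// rdot_unit rdotC convZ rdot_conjZ conjcK -convZ -(Re_H2dot w_adm _ _ fa sa).
  rewrite -rK; last first.
    rewrite (leq_trans (size_scale_leq _ _))// (leq_trans (size_polyD _ _))//.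
    by rewrite geq_max sq size_polyN.
  rewrite hornerZ horner_coef0 /conv big_ord1 subnn; case: w_adm => _ -> _.
  by rewrite mulr1 mulrC subrr.
by rewrite mulr0 addr0 expr1n mul1r lerDl sqnorm_ge0.
Qed.

Lemma kernel_approximant_zero z : kernel_zero w z -> approximant_zero w z.
Proof.
move=> [f [n [K [Hf f0 kK Kz]]]]; have [a [fa sa]] := (H2P w_adm f).1 Hf.
exists f, n, ((a 0%N)^*%C *: K 0); split; [exact: Hf|exact: f0| |].
  exact: kernel_optimal_approximant fa sa kK.
by rewrite /root hornerZ (eqP Kz) mulr0.
Qed.

End KernelToApproximant.

(** * Constructing a zero inside the disk *)

Section InteriorZero.
Variable R : realType.
Local Notation C := (R[i]^o).
Variable w : nat -> R.
Hypothesis w_adm : admissible_weight w.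

Let w_gt0 n : 0 < w n. Proof. by case: w_adm. Qed.

(** Absolute values keep the squares and do not decrease the form. Coordinate 0 is then raised by a
    small [e], because it will determine [f(0)], which must not vanish. *)
Lemma positive_test_vector : ~ jacobi_form_le (jacobi_weight w) 2 ->
  exists N x, [/\ 0 < x 0%N, forall n, (N < n)%N -> x n = 0 &
    \sum_(n < N.+1) x n ^+ 2 < \sum_(n < N) jacobi_weight w n * (x n * x n.+1)].
Proof.
move=> /existsNP[N] /existsNP[x] /negP; rewrite -ltNge ltr_pM2l//.
set D := \sum_(n < N.+1) _; set Q := \sum_(n < N) _ => DQ.
(* Raising coordinate 0 adds [e * (2 * |x 0| + e)] to the squares; with this [e < 1] that stays
   below the slack [Q - D]. *)
pose e := (Q - D) / (Q - D + 2 * `|x 0%N| + 1).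
have x0 : 0 <= `|x 0%N| by [].
have e0 : 0 < e by rewrite divr_gt0//; lra.
have e1 : e * (2 * `|x 0%N| + e) < Q - D.
  have eE : e * (Q - D + 2 * `|x 0%N| + 1) = Q - D by rewrite /e mulfVK// gt_eqF//; lra.
  have : e < 1 by rewrite /e ltr_pdivrMr; lra.
  by move=> e_lt1; rewrite -[ltRHS]eE ltr_pM2l//; lra.
pose y n := if (n <= N)%N then `|x n| + (if n is 0%N then e else 0) else 0.
exists N, y; split.
- by rewrite /y /= ltr_wpDl.
- by move=> n; rewrite /y ltnNge => /negPf->.
have -> : \sum_(n < N.+1) y n ^+ 2 = D + e * (2 * `|x 0%N| + e).
  rewrite /D !big_ord_recl /y /=.
  rewrite (eq_bigr (fun i : 'I_N => x (lift ord0 i) ^+ 2)); last first.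
    by move=> i _; rewrite /= ltn_ord addr0 real_normK ?num_real.
  by rewrite -(real_normK (num_real (x 0%N))); ring.
apply: (@lt_le_trans _ _ Q); first by rewrite -ltrBrDl.
apply: ler_sum => i _; rewrite ler_wpM2l ?sqrtr_ge0//.
apply: (le_trans (ler_norm _)); rewrite normrM /y (ltnW (ltn_ord i)) ltn_ord addr0.
by rewrite ler_wpM2r// lerDl; case: (nat_of_ord i) => //; exact: ltW.
Qed.

Definition fdot M (u v : nat -> C) : R[i] :=
  \sum_(n < M) u n * (v n)^*%C * (w n)%:C.

Lemma H2dot_fdot M f g u v : expands_as f u -> expands_as g v ->
  (forall n, (M <= n)%N -> u n = 0) -> H2dot w f g = fdot M u v.
Proof.
move=> fu gv uM; rewrite /H2dot (coefsE fu) (coefsE gv).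
apply: (cvg_lim (@norm_hausdorff _ C)); apply: cvg_near_cst.
exists M => // m /= Mm; rewrite /series /= (@big_cat_nat _ _ _ M)//= big_mkord.
rewrite [X in _ + X]big1_seq ?addr0// => i /andP[_].
by rewrite mem_index_iota => /andP[/uM-> _]; rewrite !mul0r.
Qed.

Lemma fdotDZl M (s t : R[i]) u u' v :
  fdot M (s *: u + t *: u') v = s * fdot M u v + t * fdot M u' v.
Proof.
rewrite /fdot !mulr_sumr -big_split; apply: eq_bigr => i _ /=.
have h (x x' y z : R[i]) : (s * x + t * x') * y * z = s * (x * y * z) + t * (x' * y * z) by ring.
exact: h.
Qed.

Lemma fdotC M u v : fdot M u v = (fdot M v u)^*%C.
Proof.
rewrite /fdot rmorph_sum; apply: eq_bigr => i _.
have conjM (x y : R[i]) t : x * y^*%C * t%:C = (y * x^*%C * t%:C)^*%C.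
  by case: x y => p q [r s] /=; congr (_ +i* _); ring.
exact: conjM.
Qed.

Lemma fdot_self M u : fdot M u u = (\sum_(n < M) normc (u n) ^+ 2 * w n)%:C.
Proof.
rewrite /fdot rmorph_sum; apply: eq_bigr => i _ /=.
by rewrite rmorphM /= rmorphXn /= -normE sqr_normc.
Qed.

(* The linear factor [X - z] and [X] are orthogonal after multiplication by [f], so the
   kernel of polynomials of degree at most one is diagonal in that basis, and
   [X] vanishes at the origin. *)
Lemma kernel_zero_quotient (N : nat) (r : nat -> R) :
  r 0%N != 0 -> (forall n, (N < n)%N -> r n = 0) ->
  let A := \sum_(n < N.+1) r n ^+ 2 * w n.+1 in
  let B := \sum_(n < N) r n * r n.+1 * w n.+1 in
  0 < A -> 0 < B -> kernel_zero w (A / B)%:C.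
Proof.
move=> r0 rN A B A0 B0; set z : R[i] := (A / B)%:C.
have z0 : z != 0 by rewrite eq_complex /= eqxx andbT gt_eqF// divr_gt0.
pose g n : C := (r n)%:C.
have gN n : (N.+1 <= n)%N -> g n = 0 by move=> Nn; rewrite /g rN.
pose f (z : C) : C := \sum_(i < N.+1) g i * z ^+ i.
have fg : expands_as f g by exact: expands_as_finite.
pose E1 := shift g; pose E0 := E1 - z *: g.
have E1N n : (N.+2 <= n)%N -> E1 n = 0 by case: n => // n; exact: gN.
have E0N n : (N.+2 <= n)%N -> E0 n = 0.
  move=> Nn; rewrite -[E0 n]/(E1 n - z * g n) E1N// gN ?mulr0 ?subr0//.
  exact: ltnW.
have D11 : fdot N.+2 E1 E1 = A%:C.
  rewrite fdot_self big_ord_recl /= normc0 expr0n mul0r add0r.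
  by congr (_%:C); apply: eq_bigr => i _; rewrite normc_real real_normK ?num_real.
have Dg1 : fdot N.+2 g E1 = B%:C.
  rewrite /fdot big_ord_recl [E1 _](_ : _ = (0 : R[i]))// conjc0 mulr0 mul0r add0r.
  rewrite big_ord_recr /=.
  rewrite /g rN// mul0r mul0r addr0 rmorph_sum; apply: eq_bigr => i _.
  have realM (p q s : R) : p%:C * (q%:C)^*%C * s%:C = (q * p * s)%:C.
    by rewrite conjc_real -!rmorphM [p * q]mulrC.
  exact: realM.
(* The value of [z] is made for this: the pairing is [A - (A / B) * B]. *)
have D01 : fdot N.+2 E0 E1 = 0.
  rewrite -[E0]/(E1 - z *: g) -[E1 in X in fdot _ X _]scale1r -scaleNr fdotDZl D11 Dg1.
  by rewrite mul1r -rmorphN -!rmorphM -rmorphD /= mulNr mulfVK ?subrr// gt_eqF.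
have D10 : fdot N.+2 E1 E0 = 0 by rewrite fdotC D01 conjc0.
set d0 := \sum_(n < N.+2) normc (E0 n) ^+ 2 * w n.
have D00 : fdot N.+2 E0 E0 = d0%:C by rewrite fdot_self.
have d00 : 0 < d0.
  rewrite /d0 big_ord_recl ltr_wpDr ?sumr_ge0// => [i _|].
    by rewrite mulr_ge0 ?sqr_ge0 ?ltW.
  rewrite mulr_gt0// exprn_gt0// lt_neqAle normc_ge0 andbT eq_sym normc_eq0.
  rewrite -[E0 _]/(0 - z * g 0%N) sub0r oppr_eq0 mulf_neq0//.
  by rewrite eq_complex /= eqxx andbT.
pose e0 : {poly R[i]} := 'X - z%:P.
(* The kernel in an orthogonal basis: each basis polynomial, times its conjugated value at [v], over
   its squared norm. *)
pose K (v : R[i]) : {poly R[i]} := ((v - z)^*%C * (d0^-1)%:C) *: e0 + (v^*%C * (A^-1)%:C) *: 'X.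
have cX : conv 'X g = E1 by rewrite -[X in conv X]mul1r convMX -[1]/(1%:P) convC scale1r.
have ce0 : conv e0 g = E0 by rewrite convB cX convC.
exists f, 1%N, K; split.
- by apply/(H2P w_adm); exists g; split => //; exact: square_summable_finite gN.
- by rewrite (expands_as0 fg) eq_complex /= eqxx andbT.
- move=> v; split.
    rewrite (leq_trans (size_polyD _ _))// geq_max !(leq_trans (size_scale_leq _ _))//.
      by rewrite size_polyX.
    by rewrite size_XsubC.
  move=> q sq; set s := - q`_0 / z; set t := q`_1 - s.
  have qE : q = s *: e0 + t *: 'X.
    apply/polyP => -[|[|i]]; rewrite coefD !coefZ coefB coefX coefC /=.
    - by rewrite mulr0 addr0 sub0r mulrN mulfVK// opprK.
    - by rewrite subr0 !mulr1 /t addrC subrK.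
    - by rewrite nth_default ?(leq_trans sq)// subr0 !mulr0 addr0.
  rewrite (H2dot_fdot (M := N.+2) (expands_as_polymul fg) (expands_as_polymul fg)); last first.
    move=> n Nn; rewrite qE convD !convZ cX ce0.
    by rewrite -[LHS]/(s * E0 n + t * E1 n) E0N// E1N// !mulr0 addr0.
  set c0 := (v - z)^*%C * (d0^-1)%:C; set c1 := v^*%C * (A^-1)%:C.
  have -> : conv q g = s *: E0 + t *: E1 by rewrite qE convD !convZ cX ce0.
  have -> : conv (K v) g = c0 *: E0 + c1 *: E1 by rewrite convD !convZ cX ce0.
  rewrite fdotDZl [fdot _ E0 _]fdotC [fdot _ E1 _]fdotC !fdotDZl D00 D01 D10 D11.
  have cancel (x : R[i]) (d : R) : 0 < d -> (x^*%C * (d^-1)%:C * d%:C)^*%C = x.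
    by move=> d_gt0; rewrite -mulrA -rmorphM /= mulVf ?gt_eqF// mulr1 conjcK.
  rewrite !mulr0 addr0 add0r !cancel//; clearbody s t.
  by rewrite qE hornerD !hornerZ hornerXsubC hornerX.
- rewrite /root /K.
  by rewrite conjc0 mul0r scale0r addr0 hornerZ hornerXsubC subrr mulr0.
Qed.

End InteriorZero.

(** * The norm criterion and nondecreasing weights *)

Section MainResults.
Variable R : realType.
Local Notation C := (R[i]^o).
Implicit Type w : nat -> R.

Lemma exists_interior_kernel_zero w : admissible_weight w ->
  (2%:E < l2_opnorm (jacobi w))%E -> exists2 z : R[i], `|z| < 1 & kernel_zero w z.
Proof.
move=> w_adm; have [w_gt0 _ _] := w_adm.
rewrite ltNge => /negP; rewrite (l2_opnorm_leP _ (_ : 0 < 2))// => J2.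
have [N [x [x0 xN AB]]] := positive_test_vector J2.
(* This undoes the substitution [x_n = |g_n| sqrt(w_(n+1))]. *)
pose r n := x n / Num.sqrt (w n.+1).
have sw n : 0 < Num.sqrt (w n) by rewrite sqrtr_gt0.
have rA n : r n ^+ 2 * w n.+1 = x n ^+ 2.
  by rewrite /r expr_div_n sqr_sqrtr ?ltW// mulfVK// gt_eqF.
have rB n : r n * r n.+1 * w n.+1 = jacobi_weight w n * (x n * x n.+1).
  rewrite /r /jacobi_weight sqrtrM ?(ltW (w_gt0 _))// sqrtrV ?(ltW (w_gt0 _))//.
  rewrite -[X in _ * X = _](sqr_sqrtr (ltW (w_gt0 n.+1))).
  by field; rewrite !gt_eqF.
have A0 : 0 < \sum_(n < N.+1) x n ^+ 2.
  rewrite big_ord_recl ltr_wpDr ?exprn_gt0//.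
  by apply: sumr_ge0 => i _; rewrite sqr_ge0.
have r0 : r 0%N != 0 by rewrite gt_eqF// divr_gt0.
have rN n : (N < n)%N -> r n = 0 by move=> Nn; rewrite /r xN// mul0r.
have := kernel_zero_quotient w_adm r0 rN.
have -> : \sum_(n < N.+1) r n ^+ 2 * w n.+1 = \sum_(n < N.+1) x n ^+ 2.
  by apply: eq_bigr => i _; exact: rA.
have -> : \sum_(n < N) r n * r n.+1 * w n.+1 =
    \sum_(n < N) jacobi_weight w n * (x n * x n.+1).
  by apply: eq_bigr => i _; exact: rB.
move=> /(_ A0 (lt_trans A0 AB)) Kz; eexists; last exact: Kz.
have B0 := lt_trans A0 AB.
by rewrite norm_lt1 normc_real gtr0_norm ?divr_gt0// ltr_pdivrMr// mul1r.
Qed.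

(** The implications form a circle: a kernel zero is an approximant zero, an approximant zero in the
    disk forces norm above 2, and norm above 2 produces a kernel zero in the disk. *)
Lemma interior_zeroP w : admissible_weight w ->
  ((exists2 z : R[i], `|z| < 1 & approximant_zero w z) <->
     (2%:E < l2_opnorm (jacobi w))%E) /\
  ((exists2 z : R[i], `|z| < 1 & kernel_zero w z) <->
     (2%:E < l2_opnorm (jacobi w))%E).
Proof.
move=> w_adm; have [w_gt0 _ _] := w_adm.
have ap : (exists2 z : R[i], `|z| < 1 & approximant_zero w z) ->
    (2%:E < l2_opnorm (jacobi w))%E.
  move=> [z z1 /(approximant_orthogonal_zero w_adm) oz]; rewrite ltNge.
  apply/negP; rewrite (l2_opnorm_leP _ (_ : 0 < 2))// => J2.
  have := le_lt_trans (orthogonal_zero_ge1 w_adm J2 oz) z1.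
  by rewrite ltxx.
have ker : (exists2 z : R[i], `|z| < 1 & kernel_zero w z) ->
    exists2 z : R[i], `|z| < 1 & approximant_zero w z.
  by move=> [z z1 kz]; exists z => //; exact: kernel_approximant_zero.
split; split=> [|J2]; first exact: ap.
- exact: ker (exists_interior_kernel_zero w_adm J2).
- by move/ker/ap.
- exact: exists_interior_kernel_zero.
Qed.

Lemma l2_opnorm_nondecreasing w : admissible_weight w ->
  (forall n, w n <= w n.+1) -> l2_opnorm (jacobi w) = 2%:E.
Proof.
move=> [w_gt0 _ w1] ww; apply/eqP; rewrite eq_le; apply/andP; split.
  rewrite (l2_opnorm_leP _ (_ : 0 < 2))//; apply: jacobi_form_le2 => n.
  rewrite sqrtr_ge0 -[X in _ <= X]sqrtr1 ler_wsqrtr// ler_pdivrMr// mul1r.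
  exact: ww.
have c1 : jacobi_weight w @ \oo --> (1 : R).
  rewrite -[jacobi_weight w]/(fun n => Num.sqrt (w n.+1 / w n.+2)) -[X in _ --> X]sqrtr1.
  apply: continuous_cvg; first exact: sqrt_continuous.
  by have := w1; rewrite -(cvg_shiftS _).
rewrite leNgt; apply/negP => J2.
(* The bound on the form asks for a positive real [r], hence the maximum with 1. *)
have [r [r0 r2 Jr]] : exists r, [/\ 0 < r, r < 2 & (l2_opnorm (jacobi w) <= r%:E)%E].
  move: J2; case: (l2_opnorm _) => [s||] //; last by exists 1; split; rewrite ?leNye//; lra.
  rewrite lte_fin => s2; exists (Num.max s 1).
  by split; rewrite ?lt_max ?gt_max ?lee_fin ?le_max ?lexx ?ltr01 ?orbT ?s2//=; lra.
move/(l2_opnorm_leP w r0) in Jr.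
by have := jacobi_form_ge2 c1 Jr; rewrite leNgt r2.
Qed.

Definition delta_seq k : nat -> C := fun n => (n == k)%:R.

Lemma expands_as_delta k :
  expands_as (fun z : C => \sum_(i < k.+1) delta_seq k i * z ^+ i) (delta_seq k).
Proof. by apply: expands_as_finite => i ki; rewrite /delta_seq gtn_eqF. Qed.

Lemma square_summable_delta w k : square_summable w (delta_seq k).
Proof.
by apply: (square_summable_finite (n := k.+1)) => i ki; rewrite /delta_seq gtn_eqF.
Qed.

Lemma sqnorm_delta w k : sqnorm w (delta_seq k) = w k.
Proof.
apply: cvg_lim => //; apply: cvg_near_cst; exists k.+1 => // n /= kn.
rewrite /series /= big_mkord (bigD1 (Ordinal kn))//= /delta_seq eqxx normc1 expr1n mul1r.
rewrite big1 ?addr0// => i ik; rewrite (negPf (_ : (i != k :> nat)%N)) ?normc0 ?expr0n ?mul0r//.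
Qed.

Lemma H2norm_shift w f a : admissible_weight w -> expands_as f a -> square_summable w a ->
  (H2norm w f <= H2norm w (fun z => (z * f z)%R))%E = (sqnorm w a <= sqnorm w (shift a)).
Proof.
move=> w_adm fa sa; have [w_gt0 _ _] := w_adm.
rewrite /H2norm (coefsE fa) (coefsE (expands_as_shift fa)) (weighted_norm_leP w_gt0)//.
exact: square_summable_shift.
Qed.

(** On the monomial of degree [n] the squared norm is [w n], so monomials detect every inequality;
    conversely the norms compare term by term. *)
Lemma shift_norm_nondecreasingP w : admissible_weight w ->
  shift_norm_nondecreasing w <-> forall n, w n <= w n.+1.
Proof.
move=> w_adm; have [w_gt0 _ _] := w_adm; split=> [sw n|ww f].
  have hd := expands_as_delta (k := n); have sd := square_summable_delta (w := w) (k := n).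
  have Hd : H2 w (fun z : C => \sum_(i < n.+1) delta_seq n i * z ^+ i).
    by apply/(H2P w_adm); exists (delta_seq n).
  have := sw _ Hd; rewrite (H2norm_shift w_adm hd sd) sqnorm_delta.
  rewrite (_ : shift (delta_seq n) = delta_seq n.+1) ?sqnorm_delta//.
  by apply/funext => -[|k].
by move=> /(H2P w_adm)[a [fa sa]]; rewrite (H2norm_shift w_adm fa sa) sqnorm_le_shift.
Qed.

Lemma zero_gt1 w : admissible_weight w -> (forall n, w n <= w n.+1) ->
  (forall z : R[i], approximant_zero w z -> 1 < `|z|) /\
  (forall z : R[i], kernel_zero w z -> 1 < `|z|).
Proof.
move=> w_adm ww; have ap z : approximant_zero w z -> 1 < `|z|.
  by move=> /(approximant_orthogonal_zero w_adm); exact: orthogonal_zero_gt1.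
by split=> [|z /(kernel_approximant_zero w_adm)]; exact: ap.
Qed.

Lemma le_inf_ratio w : (forall n, 0 < w n) ->
  1 <= inf (range (fun n => w n.+1 / w n)) -> forall n, w n <= w n.+1.
Proof.
move=> w_gt0 w1 n; rewrite -[leLHS]mul1r -ler_pdivlMr//; apply: le_trans w1 _.
apply: ge_inf; last by exists n.
(* Positivity bounds the ratios below, so [inf] is a genuine infimum and not a default value. *)
by exists 0 => _ [k _ <-]; rewrite divr_ge0// ltW.
Qed.

Lemma dirichlet_weight_nondecreasing (alpha : R) : 0 <= alpha ->
  forall n, dirichlet_weight alpha n <= dirichlet_weight alpha n.+1.
Proof.
by move=> a0 n; rewrite /dirichlet_weight ge0_ler_powR ?nnegrE// ler_nat.
Qed.

Lemma dirichlet_weight_admissible (alpha : R) : 0 <= alpha ->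
  admissible_weight (dirichlet_weight alpha).
Proof.
move=> a0; split=> [n||]; rewrite /dirichlet_weight.
- by rewrite powR_gt0.
- by rewrite powR1.
have h : (fun n => 1 - n.+2%:R^-1 : R) @ \oo --> (1 : R).
  rewrite -[X in _ --> X]subr0; apply: cvgB; first exact: cvg_cst.
  by have := @cvg_harmonic R; rewrite -(cvg_shiftS _).
(* The ratio is [(1 - 1 / (n + 2)) ^ alpha]; the exponential form lets continuity of [expR] and [ln]
   give the limit. *)
have -> : (fun n => n.+1%:R `^ alpha / n.+2%:R `^ alpha) =
    (fun n => expR (alpha * ln (1 - n.+2%:R^-1 : R))).
  apply/funext => n; have u0 : (0 : R) < 1 - n.+2%:R^-1.
    by rewrite subr_gt0 invf_lt1 ?ltr1n.
  apply: (mulIf (lt0r_neq0 (powR_gt0 alpha (ltr0Sn R n.+1)))).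
  rewrite mulfVK ?gt_eqF ?powR_gt0//.
  have -> : expR (alpha * ln (1 - n.+2%:R^-1)) = (1 - n.+2%:R^-1) `^ alpha.
    by rewrite /powR gt_eqF.
  rewrite -powRM ?(ltW u0)//; congr (_ `^ _).
  by rewrite mulrBl mulVf// mul1r -[n.+2%:R]natr1 addrK.
rewrite -[X in _ --> X]expR0; apply: continuous_cvg; first exact: continuous_expR.
rewrite -[X in _ --> X](mulr0 alpha); apply: cvgMl_tmp.
rewrite -[X in _ --> X](ln1 R); apply: continuous_cvg; last exact: h.
exact: continuous_ln.
Qed.

End MainResults.

Theorem corollary4p3 (R : realType) :
  (forall w : nat -> R, admissible_weight w ->
    (* (i) *)
    (((exists2 z : R[i], `|z| < 1 & approximant_zero w z) <->
        (2%:E < l2_opnorm (jacobi w))%E) /\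
     ((exists2 z : R[i], `|z| < 1 & kernel_zero w z) <->
        (2%:E < l2_opnorm (jacobi w))%E)) /\
    (* (ii) *)
    (l2_opnorm (jacobi w) = 2%:E ->
      ((forall z : R[i], approximant_zero w z -> 1 <= `|z|) /\
       (forall z : R[i], kernel_zero w z -> 1 <= `|z|)) /\
      (shift_norm_nondecreasing w ->
        (forall z : R[i], approximant_zero w z -> 1 < `|z|) /\
        (forall z : R[i], kernel_zero w z -> 1 < `|z|))) /\
    (1 <= inf (range (fun n => w n.+1 / w n)) ->
      [/\ l2_opnorm (jacobi w) = 2%:E, shift_norm_nondecreasing w,
          forall z : R[i], approximant_zero w z -> 1 < `|z|
        & forall z : R[i], kernel_zero w z -> 1 < `|z|])) /\
  (forall alpha : R, 0 <= alpha ->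
    [/\ admissible_weight (dirichlet_weight alpha),
        l2_opnorm (jacobi (dirichlet_weight alpha)) = 2%:E,
        shift_norm_nondecreasing (dirichlet_weight alpha),
        forall z : R[i], approximant_zero (dirichlet_weight alpha) z -> 1 < `|z|
      & forall z : R[i], kernel_zero (dirichlet_weight alpha) z -> 1 < `|z|]).
Proof.
have nondecreasing w : admissible_weight w -> (forall n, w n <= w n.+1) ->
    [/\ l2_opnorm (jacobi w) = 2%:E, shift_norm_nondecreasing w,
        forall z : R[i], approximant_zero w z -> 1 < `|z|
      & forall z : R[i], kernel_zero w z -> 1 < `|z|].
  move=> w_adm ww; have [ap ker] := zero_gt1 w_adm ww; split; last exact: ker.
  - exact: l2_opnorm_nondecreasing.
  - exact/shift_norm_nondecreasingP.
  - exact: ap.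
split=> [w w_adm|alpha a0]; last first.
  have w_adm := dirichlet_weight_admissible a0.
  have [J2 S ap ker] := nondecreasing _ w_adm (dirichlet_weight_nondecreasing a0).
  by split; [exact: w_adm|exact: J2|exact: S|exact: ap|exact: ker].
have [w_gt0 _ _] := w_adm; split; first exact: interior_zeroP.
split=> [J2|w1]; last exact/nondecreasing/le_inf_ratio.
have ap z : approximant_zero w z -> 1 <= `|z|.
  move=> /(approximant_orthogonal_zero w_adm); apply: orthogonal_zero_ge1 => //.
  by apply/l2_opnorm_leP => //; rewrite J2.
split; last by move=> /(shift_norm_nondecreasingP w_adm); exact: zero_gt1.
by split=> [|z /(kernel_approximant_zero w_adm)]; exact: ap.
Qed.
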